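(* Assume that $\mathbb{F}$ is algebraically closed and $q$ is not a root of unity. If $V$ is a finite-dimensional irreducible $\mathfrak{H}_q$-module, then the following (i) or (ii) holds: (i) $t_3$ and $t_0$ have a simultaneous eigenvector in $V$. (ii) $t_1$ and $t_2$ have a simultaneous eigenvector in $V$.
   Context: $\mathbb{F}$ is a field and $q\in\mathbb{F}$ is nonzero. The universal DAHA $\mathfrak{H}_q$ of type $(C_1^\vee,C_1)$ is the unital associative $\mathbb{F}$-algebra with generators $t_0^{\pm1},t_1^{\pm1},t_2^{\pm1},t_3^{\pm1}$ and relations: $t_it_i^{-1}=t_i^{-1}t_i=1$ for all $i$; $t_i+t_i^{-1}$ is central for all $i$; $t_0t_1t_2t_3=q^{-1}$. A simultaneous eigenvector of two elements is a nonzero vector that is an eigenvector of both. *)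

(* Defs.v *)
From HB Require Import structures.
From mathcomp Require Import all_boot all_order all_algebra.
From mathcomp Require Import boolp monalg.

Set Implicit Arguments.
Unset Strict Implicit.
Unset Printing Implicit Defensive.

Import GRing.Theory.

Local Open Scope ring_scope.
Local Open Scope quotient_scope.

(* Letters: (i, false) stands for t_i and (i, true) for t_i^-1. *)
Definition daha_letter : choiceType := ('I_4 * bool)%type.

(* The free unital associative F-algebra on the eight letters, as the monoid  *)
(* algebra of the free monoid.                                                *)
Definition daha_free (F : fieldType) := {malg F[{fmonom daha_letter}]}.
HB.instance Definition _ (F : fieldType) := GRing.Lalgebra.on (daha_free F).

Section FreeAlgebra.
Variable F : fieldType.

Fact daha_free_scalerAr (c : F) (a b : daha_free F) :
  c *: (a * b) = a * (c *: b).
Proof.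
have comC (g : daha_free F) : g * c%:MP = c%:MP * g.
  rewrite !malgM_def fgmulUg fgmulgU; apply: eq_bigr => k _.
  by rewrite mulrC mulm1 mul1m.
by rewrite -!mul_malgC !mulrA comC.
Qed.

HB.instance Definition _ :=
  GRing.Lalgebra_isAlgebra.Build F (daha_free F) daha_free_scalerAr.

End FreeAlgebra.

Section Presentation.
Variables (F : fieldType) (q : F).

Definition letter (x : daha_letter) : daha_free F := << fmu x >>.

Local Notation T i := (letter (i, false)).
Local Notation Tinv i := (letter (i, true)).

Inductive daha_rel : daha_free F -> daha_free F -> Prop :=
| DahaMulV i : daha_rel (T i * Tinv i) 1
| DahaVMul i : daha_rel (Tinv i * T i) 1
| DahaCentral i a : daha_rel ((T i + Tinv i) * a) (a * (T i + Tinv i))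
| DahaProd : daha_rel (T 0 * T 1 * T 2 * T 3) (q^-1)%:A.

(* The two-sided ideal generated by the differences a - b of related a and b; *)
(* it is closed under opposite since it is closed under product with -1.      *)
Inductive daha_ideal : daha_free F -> Prop :=
| DahaIdealRel a b : daha_rel a b -> daha_ideal (a - b)
| DahaIdeal0 : daha_ideal 0
| DahaIdealD a b : daha_ideal a -> daha_ideal b -> daha_ideal (a + b)
| DahaIdealMl a b : daha_ideal b -> daha_ideal (a * b)
| DahaIdealMr a b : daha_ideal a -> daha_ideal (a * b).

Definition in_daha_ideal : {pred daha_free F} := fun a => `[< daha_ideal a >].

Lemma in_daha_idealP a : reflect (daha_ideal a) (a \in in_daha_ideal).
Proof. exact: asboolP. Qed.

Fact daha_ideal_zmod_closed : zmod_closed in_daha_ideal.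
Proof.
split=> [|a b /in_daha_idealP Ia /in_daha_idealP Ib].
  exact/in_daha_idealP/DahaIdeal0.
apply/in_daha_idealP/DahaIdealD => //; rewrite -mulN1r.
exact: DahaIdealMl.
Qed.

HB.instance Definition _ :=
  GRing.isZmodClosed.Build (daha_free F) in_daha_ideal daha_ideal_zmod_closed.

(* For nonzero q the algebra is nontrivial, since it has the character        *)
(* sending t_0 to q^-1 and t_1, t_2, t_3 to 1.                                *)
Let chi_letter (x : daha_letter) : F :=
  if x.1 == 0 then if x.2 then q else q^-1 else 1.

Let chi_word (m : {fmonom daha_letter}) : F := \prod_(x <- m) chi_letter x.

Let chi_word_morph : monalg.mmorphism chi_word.
Proof.
split=> [m1 m2|]; rewrite /chi_word; first by rewrite fmM big_cat.
by rewrite fm1 big_nil.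
Qed.

HB.instance Definition _ := monalg.isMultiplicative.Build
  {fmonom daha_letter} F chi_word chi_word_morph.

Let chi : daha_free F -> F := mmap idfun chi_word.

Let chiM a b : chi (a * b) = chi a * chi b.
Proof. exact: (mmap_is_multiplicative (f := idfun) (h := chi_word)).1. Qed.

Let chiC a b : chi (a * b) = chi (b * a).
Proof. exact: etrans (chiM a b) (etrans (mulrC _ _) (esym (chiM b a))). Qed.

Let chi1 : chi 1 = 1.
Proof. exact: mmap1. Qed.

Let chiB a b : chi (a - b) = chi a - chi b.
Proof. exact: mmapB. Qed.

Let chiD a b : chi (a + b) = chi a + chi b.
Proof. exact: mmapD. Qed.

Let chi_lett x : chi (letter x) = chi_letter x.
Proof. by rewrite /chi /letter mmapU /= mul1r /chi_word fmU big_seq1. Qed.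

Fact daha_ideal_proper : q != 0 -> 1 \notin in_daha_ideal.
Proof.
move=> q0; apply/in_daha_idealP => I1.
have chi0 a : daha_ideal a -> chi a = 0.
  elim=> {a} [a b ab||a b _ Ia _ Ib|a b _ Ib|a b _ Ia]; last 1 first.
  - by rewrite chiM Ia mul0r.
  - rewrite chiB; apply/eqP; rewrite subr_eq0; apply/eqP; case: ab.
    + move=> i; rewrite chiM !chi_lett chi1 /chi_letter /=.
      by case: ifP; rewrite ?mulr1 ?mulVf.
    + move=> i; rewrite chiM !chi_lett chi1 /chi_letter /=.
      by case: ifP; rewrite ?mulr1 ?mulfV.
    + move=> i c; exact: chiC.
    + rewrite 3!chiM !chi_lett /chi_letter /= !mulr1.
      by rewrite -mul_malgC mulr1 /chi mmapC.
  - by rewrite /chi mmap0.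
  - by rewrite chiD Ia Ib addr0.
  - by rewrite chiM Ib mulr0.
by have /eqP := chi0 1 I1; rewrite chi1 oner_eq0.
Qed.

Definition daha of q != 0 : Type := Quotient.quot in_daha_ideal.

Section Quotient.
Variable q0 : q != 0.
Local Notation H := (daha q0).

HB.instance Definition _ := Choice.on H.
HB.instance Definition _ := GRing.Zmodule.on H.

Definition daha_pi (a : daha_free F) : H :=
  \pi_(Quotient.quot in_daha_ideal) a.
Definition daha_repr (x : H) : daha_free F :=
  repr (x : Quotient.quot in_daha_ideal).

Lemma daha_reprK : cancel daha_repr daha_pi.
Proof. exact: reprK. Qed.

Lemma daha_piP a b : daha_pi a = daha_pi b <-> daha_ideal (a - b).
Proof.
rewrite /daha_pi; split=> [/eqP|/in_daha_idealP].
  by rewrite -Quotient.idealrBE => /in_daha_idealP.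
by rewrite Quotient.idealrBE => /eqP.
Qed.

Lemma daha_piD a b : daha_pi (a + b) = daha_pi a + daha_pi b.
Proof. exact: Quotient.pi_add. Qed.

Definition daha_mul (x y : H) : H := daha_pi (daha_repr x * daha_repr y).
Definition daha_scale (c : F) (x : H) : H := daha_pi (c *: daha_repr x).

Lemma daha_mulE a b : daha_mul (daha_pi a) (daha_pi b) = daha_pi (a * b).
Proof.
apply/daha_piP.
have /daha_piP Ia := daha_reprK (daha_pi a).
have /daha_piP Ib := daha_reprK (daha_pi b).
move: (daha_repr (daha_pi a)) (daha_repr (daha_pi b)) Ia Ib => a' b' Ia Ib.
have -> : a' * b' - a * b = (a' - a) * b' + a * (b' - b).
  by rewrite mulrBl mulrBr addrA subrK.
by apply: DahaIdealD; [apply: DahaIdealMr | apply: DahaIdealMl].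
Qed.

Lemma daha_scaleE c a : daha_scale c (daha_pi a) = daha_pi (c *: a).
Proof.
apply/daha_piP; rewrite -scalerBr -mulr_algl.
by apply/DahaIdealMl/daha_piP; rewrite daha_reprK.
Qed.

Fact daha_mulA : associative daha_mul.
Proof.
move=> x y z; rewrite -[x]daha_reprK -[y]daha_reprK -[z]daha_reprK.
by rewrite !daha_mulE mulrA.
Qed.

Fact daha_mul1 : left_id (daha_pi 1) daha_mul.
Proof. by move=> x; rewrite -[x]daha_reprK daha_mulE mul1r. Qed.

Fact daha_mulr1 : right_id (daha_pi 1) daha_mul.
Proof. by move=> x; rewrite -[x]daha_reprK daha_mulE mulr1. Qed.

Fact daha_mulDl : left_distributive daha_mul +%R.
Proof.
move=> x y z; rewrite -[x]daha_reprK -[y]daha_reprK -[z]daha_reprK.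
by rewrite -daha_piD !daha_mulE -daha_piD mulrDl.
Qed.

Fact daha_mulDr : right_distributive daha_mul +%R.
Proof.
move=> x y z; rewrite -[x]daha_reprK -[y]daha_reprK -[z]daha_reprK.
by rewrite -daha_piD !daha_mulE -daha_piD mulrDr.
Qed.

Fact daha_one_neq0 : daha_pi 1 != 0.
Proof.
apply: contra (daha_ideal_proper q0) => /eqP pi1.
have /daha_piP : daha_pi 1 = daha_pi 0.
  by rewrite pi1; apply/esym/(@addrI _ (daha_pi 0)); rewrite -daha_piD !addr0.
by rewrite subr0 => /in_daha_idealP.
Qed.

HB.instance Definition _ := GRing.Zmodule_isNzRing.Build H
  daha_mulA daha_mul1 daha_mulr1 daha_mulDl daha_mulDr daha_one_neq0.

Fact daha_scaleA a b x :
  daha_scale a (daha_scale b x) = daha_scale (a * b) x.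
Proof. by rewrite -[x]daha_reprK !daha_scaleE scalerA. Qed.

Fact daha_scale1 : left_id 1 daha_scale.
Proof. by move=> x; rewrite -[x]daha_reprK daha_scaleE scale1r. Qed.

Fact daha_scaleDr : right_distributive daha_scale +%R.
Proof.
move=> c x y; rewrite -[x]daha_reprK -[y]daha_reprK.
by rewrite -daha_piD !daha_scaleE -daha_piD scalerDr.
Qed.

Fact daha_scaleDl x : {morph daha_scale^~ x : a b / a + b}.
Proof.
by move=> a b; rewrite -[x]daha_reprK !daha_scaleE -daha_piD scalerDl.
Qed.

HB.instance Definition _ := GRing.Zmodule_isLmodule.Build F H
  daha_scaleA daha_scale1 daha_scaleDr daha_scaleDl.

Lemma daha_piM a b : daha_pi (a * b) = daha_pi a * daha_pi b.
Proof. by rewrite -daha_mulE. Qed.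

Lemma daha_piZ (c : F) a : daha_pi (c *: a) = c *: daha_pi a.
Proof. by rewrite -daha_scaleE. Qed.

Fact daha_scalerAl (c : F) (x y : H) : c *: (x * y) = (c *: x) * y.
Proof.
rewrite -[x]daha_reprK -[y]daha_reprK -daha_piM -!daha_piZ -daha_piM.
by rewrite scalerAl.
Qed.

Fact daha_scalerAr (c : F) (x y : H) : c *: (x * y) = x * (c *: y).
Proof.
rewrite -[x]daha_reprK -[y]daha_reprK -daha_piM -!daha_piZ -daha_piM.
by rewrite scalerAr.
Qed.

HB.instance Definition _ :=
  GRing.Lmodule_isLalgebra.Build F H daha_scalerAl.
HB.instance Definition _ :=
  GRing.Lalgebra_isAlgebra.Build F H daha_scalerAr.

Definition daha_t (i : 'I_4) : H := daha_pi (T i).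
Definition daha_tV (i : 'I_4) : H := daha_pi (Tinv i).

Lemma daha_tK i : daha_t i * daha_tV i = 1.
Proof. by rewrite -daha_piM; apply/daha_piP/DahaIdealRel/DahaMulV. Qed.

Lemma daha_tVK i : daha_tV i * daha_t i = 1.
Proof. by rewrite -daha_piM; apply/daha_piP/DahaIdealRel/DahaVMul. Qed.

Lemma daha_central i (x : H) :
  (daha_t i + daha_tV i) * x = x * (daha_t i + daha_tV i).
Proof.
rewrite -[x]daha_reprK -daha_piD -!daha_piM.
exact/daha_piP/DahaIdealRel/DahaCentral.
Qed.

Lemma daha_prod : daha_t 0 * daha_t 1 * daha_t 2 * daha_t 3 = (q^-1)%:A.
Proof.
have piM4 a b c d : daha_pi a * daha_pi b * daha_pi c * daha_pi d
    = daha_pi (a * b * c * d) by rewrite !daha_piM.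
apply: etrans (piM4 _ _ _ _) _; apply: etrans (daha_piZ _ _).
exact/daha_piP/DahaIdealRel/DahaProd.
Qed.

End Quotient.
End Presentation.

(* An A-module V seen as an F-space by restriction of scalars along F -> A.   *)
Definition restrict_scalars (F : fieldType) (A : algType F) (V : lmodType A) :
  Type := V.

Section RestrictScalars.
Variables (F : fieldType) (A : algType F) (V : lmodType A).
Local Notation W := (restrict_scalars V).

HB.instance Definition _ := GRing.Zmodule.on W.

Definition restrict_scale (c : F) (v : W) : W := (c%:A : A) *: (v : V).

Fact restrict_scaleA a b v :
  restrict_scale a (restrict_scale b v) = restrict_scale (a * b) v.
Proof. by rewrite /restrict_scale !scalerA mulr_algl scalerA. Qed.

Fact restrict_scale1 : left_id 1 restrict_scale.
Proof. by move=> v; rewrite /restrict_scale !scale1r. Qed.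

Fact restrict_scaleDr : right_distributive restrict_scale +%R.
Proof. by move=> c u v; rewrite /restrict_scale -scalerDr. Qed.

Fact restrict_scaleDl v : {morph restrict_scale^~ v : a b / a + b}.
Proof. by move=> a b; rewrite /restrict_scale !scalerDl. Qed.

HB.instance Definition _ := GRing.Zmodule_isLmodule.Build F W
  restrict_scaleA restrict_scale1 restrict_scaleDr restrict_scaleDl.

Definition finite_dimensional : Prop :=
  exists n : nat, inhabited (Vector.axiom n W).

Definition irreducible_module : Prop :=
  (exists v : V, v != 0) /\
  forall S : {pred V}, GRing.submod_closed S -> S =i pred1 0 \/ S =i predT.

Definition eigenvector (x : A) (v : V) : Prop :=
  v != 0 /\ exists c : F, x *: v = (c%:A : A) *: v.

Definition have_simultaneous_eigenvector (x y : A) : Prop :=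
  exists v : V, eigenvector x v /\ eigenvector y v.

End RestrictScalars.

(* Main.v *)
Require Import Defs.
From HB Require Import structures.
From mathcomp Require Import all_boot all_order all_algebra.
From mathcomp Require Import boolp monalg.

Import GRing.Theory.
Local Open Scope ring_scope.

Set Implicit Arguments.
Unset Strict Implicit.

(** Put X = t_3 t_0 and Y = t_1 t_2, so that X Y = Y X = q^-1.  Since t_3 and
    t_0 have central traces t_i + t_i^-1, both commute with X + X^-1
    ([commute_trace_prod]).  Let mu be an eigenvalue of X such that mu^-1 is
    not an eigenvalue.  Then the eigenspace of X + X^-1 for mu + mu^-1 is the
    mu-eigenspace of X, hence it is stable under t_0.  An eigenvector of t_0
    inside it is also an eigenvector of t_3 = X t_0^-1: this is case (i).  In
    the same way, an eigenvalue of Y whose inverse is not an eigenvalue of Y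
    gives case (ii).  Both are [simultaneous_eigenvector_or_inv].

    If both cases fail, the spectra of X and of Y are closed under inversion.
    They are exchanged by mu |-> (q mu)^-1, because X Y = q^-1.  Composing,
    mu |-> q^2 mu maps the spectrum of X to itself.  As q is not a root of
    unity and X is invertible, the spectrum is then infinite or empty.
    Neither is possible on a nonzero finite-dimensional space over an
    algebraically closed field, where X is annihilated by a nonzero polynomial
    that splits ([annihilating_poly]): its roots contain the spectrum
    ([eigenvalue_orbit_finite]), and its linear factors produce an eigenvector
    ([eigenvector_in_stable]). *)

Section Ring.
Variable A : pzRingType.

(** Expanding b' a' = (cb - b) (ca - a) with central ca = a + a', cb = b + b'
    shows that a b + b' a' is symmetric in a and b, so that
    b (a b + b' a') = b a b + a' = (b a + a' b') b = (a b + b' a') b. *)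
Lemma commute_trace_prod (a a' b b' : A) :
  b * b' = 1 -> b' * b = 1 ->
  (forall x, (a + a') * x = x * (a + a')) ->
  (forall x, (b + b') * x = x * (b + b')) ->
  b * (a * b + b' * a') = (a * b + b' * a') * b.
Proof.
move=> bb' b'b ca cb.
have sym : a * b + b' * a' = b * a + a' * b'.
  have a'E : a' = (a + a') - a by rewrite addrC addKr.
  have b'E : b' = (b + b') - b by rewrite addrC addKr.
  rewrite a'E b'E; move: (a + a') (b + b') ca cb => s t cs ct.
  rewrite !mulrBl !mulrBr (cs b) (ct s) (ct a) !opprB.
  by rewrite [LHS](AC (1*(2*2)) (4*((2*5)*(1*3)))).
rewrite [in RHS]sym mulrDr mulrDl [b * (b' * _)]mulrA bb' mul1r.
by rewrite -[a' * b' * b]mulrA b'b mulr1 !mulrA.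
Qed.

End Ring.

Section Module.
Variables (F : closedFieldType) (A : algType F) (V : lmodType A).

Implicit Types (x a b : A) (c : F) (v w : V) (p : {poly F}).

Definition eigenvalue_on (x : A) (c : F) : Prop :=
  exists2 v : V, v != 0 & x *: v = c%:A *: v.

Lemma scalar_scaleC x c v : x *: (c%:A *: v) = c%:A *: (x *: v).
Proof. by rewrite !scalerA mulr_algl mulr_algr. Qed.

Lemma scalar_scaleM (c d : F) v :
  (c%:A : A) *: ((d%:A : A) *: v) = (c * d)%:A *: v.
Proof. by rewrite scalerA mulr_algl scalerA. Qed.

Lemma scalar_scaleK c : c != 0 ->
  cancel (fun v => (c%:A : A) *: v) (fun v => (c^-1)%:A *: v).
Proof. by move=> c0 v; rewrite scalar_scaleM mulVf // !scale1r. Qed.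

Lemma horner_alg_eigen x c p v :
  x *: v = c%:A *: v -> horner_alg x p *: v = (p.[c])%:A *: v.
Proof.
move=> xv; elim/poly_ind: p => [|p d IHp].
  by rewrite rmorph0 horner0 !scale0r.
rewrite rmorphD rmorphM /= horner_algX horner_algC hornerMXaddC.
by rewrite !scalerDl -scalerA xv scalar_scaleC IHp scalar_scaleM mulrC.
Qed.

Lemma eigenvalue_unit_neq0 (x x' : A) (c : F) :
  x' * x = 1 -> eigenvalue_on x c -> c != 0.
Proof.
move=> x'x [v v0 xv]; apply: contra_neq v0 => c0.
by rewrite -[v]scale1r -x'x -scalerA xv c0 !scale0r scaler0.
Qed.

Lemma annihilating_poly (x : A) : finite_dimensional V ->
  exists2 p : {poly F}, p != 0 & forall v : V, horner_alg x p *: v = 0.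
Proof.
case=> n [[r r_lin r_bij]].
have rD : {morph r : u v / u + v}.
  by move=> u v; have := r_lin 1 u v; rewrite !scale1r.
have rZ c u : r ((c%:A : A) *: u) = c *: r u.
  have r0 : r 0 = 0 by apply: (@addrI _ (r 0)); rewrite -rD !addr0.
  by have := r_lin c u 0; rewrite r0 !addr0.
have [s rK sK] := r_bij.
case: n => [|n] in r s r_lin r_bij rD rZ rK sK *.
  exists 1 => [|v]; first exact: oner_neq0.
  by apply: (can_inj rK); rewrite [LHS]thinmx0 [RHS]thinmx0.
(* Transport the action of x to row vectors and use Cayley-Hamilton. *)
pose f (u : 'rV_n.+1) : 'rV_n.+1 := r (x *: (s u : V)).
have f_lin : linear f.
  move=> c u w; have sE : s (c *: u + w) = c%:A *: (s u : V) + s w :> V.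
    by apply: (can_inj rK); rewrite rD rZ !sK.
  by rewrite /f sE scalerDr scalar_scaleC rD rZ.
pose fL : {linear 'rV_n.+1 -> 'rV_n.+1} :=
  HB.pack f (GRing.isLinear.Build F _ _ _ f f_lin).
pose M := lin1_mx fL.
have rM (v : V) : r (x *: v) = r v *m M by rewrite mul_rV_lin1 /= /f rK.
have r0 : r 0 = 0 by have := rZ 0 0; rewrite !scale0r.
have rP p v : r (horner_alg x p *: v) = r v *m horner_mx M p.
  elim/poly_ind: p v => [|p d IHp] v.
    by rewrite !rmorph0 scale0r r0 mulmx0.
  rewrite !rmorphD !rmorphM /= horner_algX horner_algC horner_mx_X horner_mx_C.
  rewrite scalerDl rD rZ mulmxDr mul_mx_scalar; congr (_ + _).
  rewrite -scalerA IHp rM.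
  rewrite -mulmxA; congr (_ *m _); exact/esym/comm_horner_mx.
exists (char_poly M) => [|v]; first exact/monic_neq0/char_poly_monic.
by apply: (can_inj rK); rewrite rP Cayley_Hamilton mulmx0 r0.
Qed.

(** Factor an annihilating polynomial of x into linear factors x - c and apply
    them one by one to v: the last nonzero vector obtained is an eigenvector. *)
Lemma eigenvector_in_stable (x : A) (S : V -> Prop) (v : V) :
  finite_dimensional V ->
  (forall c w, S w -> S (x *: w - (c%:A : A) *: w)) ->
  S v -> v != 0 ->
  exists w, [/\ S w, w != 0 & exists c : F, x *: w = (c%:A : A) *: w].
Proof.
move=> /(annihilating_poly x) [p p0 pV] stabS.
have [rs pE] := closed_field_poly_normal p.
have {pV}: horner_alg x (\prod_(c <- rs) ('X - c%:P)) *: v = 0.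
  apply: (can_inj (@scalar_scaleK (lead_coef p) _)) => /=.
    by rewrite lead_coef_eq0.
  by rewrite scaler0 -(pV v) [in RHS]pE linearZ /= scalerA mulr_algl.
elim: rs v {pE} => [|c rs IHrs] v prs Sv v0.
  by move/eqP: prs; rewrite big_nil rmorph1 scale1r (negPf v0).
have [v1E|v1_neq0] := eqVneq (x *: v - c%:A *: v) 0.
  by exists v; split=> //; exists c; apply/eqP; rewrite -subr_eq0 v1E.
apply: (IHrs _ _ (stabS c v Sv) v1_neq0).
rewrite -[RHS]prs big_cons mulrC rmorphM rmorphB /= horner_algX horner_algC.
by rewrite -scalerA scalerBl.
Qed.

(** Write x = a b. With u = (x - c) (b v) and x v = c v, the identity
    (x - c^-1) (x - c) = x (x + x^-1 - c - c^-1) shows that x u = c^-1 u.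
    Hence either u is an eigenvector for c^-1, or u = 0 for all v in the
    c-eigenspace of x, which is then stable under b. *)
Lemma simultaneous_eigenvector_or_inv (a a' b b' : A) (c : F) :
  finite_dimensional V ->
  a * a' = 1 -> a' * a = 1 -> b * b' = 1 -> b' * b = 1 ->
  (forall x, (a + a') * x = x * (a + a')) ->
  (forall x, (b + b') * x = x * (b + b')) ->
  eigenvalue_on (a * b) c ->
  have_simultaneous_eigenvector V a b \/ eigenvalue_on (a * b) c^-1.
Proof.
move=> finV aa' a'a bb' b'b ca cb [v0 v0_neq0 xv0].
have [|ninv] := pselect (eigenvalue_on (a * b) c^-1); [by right | left].
have x'x : b' * a' * (a * b) = 1 by rewrite mulrA -[b' * _ * _]mulrA a'a mulr1.
have xx' : a * b * (b' * a') = 1 by rewrite mulrA -[a * _ * _]mulrA bb' mulr1.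
have bx := commute_trace_prod bb' b'b ca cb.
set x := a * b in xv0 ninv x'x xx' bx *; set x' := b' * a' in x'x xx' bx.
have c0 : c != 0 by apply: eigenvalue_unit_neq0 x'x _; exists v0.
have x'v v : x *: v = c%:A *: v -> x' *: v = (c^-1)%:A *: v.
  move=> xv; apply: (can_inj (scalar_scaleK c0)).
  by rewrite -scalar_scaleC -xv scalerA x'x scalar_scaleM mulfV // !scale1r.
have stab v : x *: v = c%:A *: v -> x *: (b *: v) = c%:A *: (b *: v).
  move=> xv; apply/eqP; rewrite -subr_eq0; apply: contra_notT ninv => u_neq0.
  exists (x *: (b *: v) - c%:A *: (b *: v)) => //.
  have trE : x *: (b *: v) + x' *: (b *: v)
      = c%:A *: (b *: v) + (c^-1)%:A *: (b *: v).
    rewrite -scalerDl scalerA -bx -scalerA scalerDl xv (x'v v xv) scalerDr.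
    by rewrite !scalar_scaleC.
  (* Clearing x^-1 gives (x^2 + 1) (b v) = (c + c^-1) x (b v). *)
  have := congr1 (fun w => x *: w) trE.
  rewrite !scalerDr [x *: (x' *: _)]scalerA xx' scale1r !scalar_scaleC => trxE.
  rewrite !scalerN scalar_scaleC.
  move/(congr1 (fun w => w - b *: v - c%:A *: (x *: (b *: v)))): trxE.
  rewrite addrK => ->; rewrite [_%:A *: _ + _]addrC scalar_scaleM.
  by rewrite mulVf // !scale1r addrAC addrK.
have stab2 d v : x *: v = c%:A *: v ->
    x *: (b *: v - d%:A *: v) = c%:A *: (b *: v - d%:A *: v).
  move=> xv; rewrite !scalerBr (stab v xv) scalar_scaleC xv.
  by rewrite !scalar_scaleM mulrC.
have [w [xw w_neq0 [d bw]]] := eigenvector_in_stable finV stab2 xv0 v0_neq0.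
have d0 : d != 0 by apply: eigenvalue_unit_neq0 b'b _; exists w.
exists w; split; split=> //; last by exists d.
exists (d^-1 * c); apply: (can_inj (scalar_scaleK d0)).
rewrite -scalar_scaleC -bw scalerA xw scalar_scaleM.
by rewrite mulrA mulfV // mul1r.
Qed.

Lemma eigenvalue_of_left_cofactor (x y : A) (q c : F) :
  q != 0 -> y * x = (q^-1)%:A -> c != 0 ->
  eigenvalue_on x c -> eigenvalue_on y (q * c)^-1.
Proof.
move=> q0 yx c0 [v v0 xv]; exists v => //.
apply: (can_inj (scalar_scaleK c0)).
rewrite -scalar_scaleC -xv scalerA yx scalar_scaleM.
by rewrite invfM mulrCA mulfV ?mulr1.
Qed.

(** The eigenvalues of x are roots of an annihilating polynomial, whereas
    c, q c, q^2 c, ... are pairwise distinct. *)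
Lemma eigenvalue_orbit_finite (x : A) (q c : F) :
  finite_dimensional V -> q != 0 ->
  (forall n : nat, (0 < n)%N -> ~~ n.-unity_root q) -> c != 0 ->
  ~ (forall n, eigenvalue_on x (q ^+ n * c)).
Proof.
move=> finV q0 qnr c0 eig; have [p p0 pV] := annihilating_poly x finV.
pose s := mkseq (fun n => q ^+ n * c) (size p).
have rs : all (root p) s.
  apply/allP => _ /mapP[n _ ->]; have [v v0 xv] := eig n.
  apply: contraNT v0 => pn; apply/eqP/(can_inj (scalar_scaleK pn)).
  by rewrite -(horner_alg_eigen _ xv) pV scaler0.
have us : uniq s.
  apply/mkseq_uniq => m n /(mulIf c0); wlog lt_mn : m n / (m < n)%N.
    move=> IH qmn; case: (ltngtP m n) => // ltmn; first exact: IH.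
    exact/esym/IH.
  move=> qmn; have /qnr/negP[] : (0 < n - m)%N by rewrite subn_gt0.
  apply/unity_rootP; apply: (mulfI (expf_neq0 m q0)).
  by rewrite -exprD subnKC ?mulr1 ?qmn // ltnW.
by have := max_poly_roots p0 rs us; rewrite size_mkseq ltnn.
Qed.

Lemma exists_eigenvalue (x : A) : finite_dimensional V ->
  (exists v : V, v != 0) -> exists c, eigenvalue_on x c.
Proof.
move=> finV [v v0].
have [w [_ w0 [c xw]]] :=
  @eigenvector_in_stable x (fun=> True) v finV (fun _ _ _ => I) I v0.
by exists c, w.
Qed.

(** Any algebra whose elements t_i satisfy the defining relations will do, so
    that no computation takes place in the quotient of the free algebra. *)
Lemma simultaneous_eigenvector_of_relations (q : F) (t tV : 'I_4 -> A) :
  q != 0 -> (forall n : nat, (0 < n)%N -> ~~ n.-unity_root q) ->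
  (forall i, t i * tV i = 1) -> (forall i, tV i * t i = 1) ->
  (forall i x, (t i + tV i) * x = x * (t i + tV i)) ->
  t 0 * t 1 * t 2 * t 3 = (q^-1)%:A ->
  finite_dimensional V -> (exists v : V, v != 0) ->
  have_simultaneous_eigenvector V (t 3) (t 0) \/
  have_simultaneous_eigenvector V (t 1) (t 2).
Proof.
move=> q_neq0 q_not_root tK tVK ct prodt finV Vneq0.
apply: contrapT => /not_orP[no30 no12].
have XY : (t 3 * t 0) * (t 1 * t 2) = (q^-1)%:A.
  transitivity (t 3 * (t 0 * t 1 * t 2 * t 3) * tV 3).
    by rewrite !mulrA -[RHS]mulrA tK mulr1.
  by rewrite prodt mulr_algr -scalerAl tK.
have YX : (t 1 * t 2) * (t 3 * t 0) = (q^-1)%:A.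
  transitivity (tV 0 * (t 0 * t 1 * t 2 * t 3) * t 0).
    by rewrite !mulrA tVK mul1r.
  by rewrite prodt mulr_algr -scalerAl tVK.
pose X := t 3 * t 0; pose Y := t 1 * t 2.
have Xinv c : eigenvalue_on X c -> eigenvalue_on X c^-1.
  by case/(simultaneous_eigenvector_or_inv finV (tK 3) (tVK 3)
             (tK 0) (tVK 0) (ct 3) (ct 0)).
have Yinv c : eigenvalue_on Y c -> eigenvalue_on Y c^-1.
  by case/(simultaneous_eigenvector_or_inv finV (tK 1) (tVK 1)
             (tK 2) (tVK 2) (ct 1) (ct 2)).
have X_neq0 c : eigenvalue_on X c -> c != 0.
  apply: (@eigenvalue_unit_neq0 X (tV 0 * tV 3)).
  by rewrite mulrA -[tV 0 * _ * _]mulrA tVK mulr1 tVK.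
have Xshift c : eigenvalue_on X c -> eigenvalue_on X (q ^+ 2 * c).
  move=> Xc; have c0 := X_neq0 c Xc; have qc0 := mulf_neq0 q_neq0 c0.
  have /Yinv := eigenvalue_of_left_cofactor q_neq0 YX c0 Xc.
  rewrite invrK => Yqc.
  have /Xinv := eigenvalue_of_left_cofactor q_neq0 XY qc0 Yqc.
  by rewrite invrK mulrA.
have [c Xc] := exists_eigenvalue X finV Vneq0.
apply: (@eigenvalue_orbit_finite X (q ^+ 2) c finV).
- exact: expf_neq0.
- move=> n n0; have := q_not_root (2 * n)%N; rewrite muln_gt0 => /(_ n0).
  by apply: contra => /unity_rootP; rewrite -exprM => /unity_rootP.
- exact: X_neq0.
elim=> [|n IHn]; first by rewrite mul1r.
by rewrite exprS -mulrA; exact: Xshift.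
Qed.

End Module.

Unset Implicit Arguments.
Set Strict Implicit.

Theorem proposition4p4 (F : closedFieldType) (q : F) (q_neq0 : q != 0)
  (q_not_root : forall n : nat, (0 < n)%N -> ~~ n.-unity_root q)
  (V : lmodType (daha q_neq0)) :
  finite_dimensional V -> irreducible_module V ->
  have_simultaneous_eigenvector V (daha_t q_neq0 3) (daha_t q_neq0 0) \/
  have_simultaneous_eigenvector V (daha_t q_neq0 1) (daha_t q_neq0 2).
Proof.
move=> finV [Vneq0 _].
exact: (simultaneous_eigenvector_of_relations q_neq0 q_not_root
  (daha_tK q_neq0) (daha_tVK q_neq0) (@daha_central _ _ q_neq0)
  (daha_prod q_neq0) finV Vneq0).
Qed.
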